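(* Suppose that $f$ is twice continuously differentiable on $U$, and let $y\in U$. Then $$(\forall w\in\mathbb{R}^J)\quad \mathrm{d}\overleftarrow{F}_C(y)(w)=\hat{\mathrm{d}}\overleftarrow{F}_C(y)(w)=\max_{x\in\overleftarrow{Q}_C(y)}\langle\nabla^2 f(y)(y-x),w\rangle$$ and $$\partial_L\overleftarrow{F}_C(y)=\hat\partial\overleftarrow{F}_C(y)=\overline{\partial}\,\overleftarrow{F}_C(y)=\nabla^2 f(y)\big[y-\operatorname{conv}\overleftarrow{Q}_C(y)\big];$$ consequently, $\overleftarrow{F}_C$ is Clarke regular on $U$.
   Context: $\mathbb{R}^J$ is the standard Euclidean space with inner product $\langle\cdot,\cdot\rangle$ and norm $\|\cdot\|$. Standing assumptions: (1) $f\colon\mathbb{R}^J\to\,]-\infty,+\infty]$ is a convex function of Legendre type, i.e., $f$ is proper, lower semicontinuous, convex, essentially smooth (with $U:=\operatorname{int}\operatorname{dom} f\neq\varnothing$, $f$ is differentiable on $U$ and $\|\nabla f(x_n)\|\to+\infty$ whenever $(x_n)$ is a sequence in $U$ converging to a boundary point of $U$) and essentially strictly convex ($f$ is strictly convex on every convex subset of $\operatorname{dom}\partial f$). (2) $f$ is $1$-coercive: $\lim_{\|x\|\to+\infty} f(x)/\|x\|=+\infty$ (equivalently, $\operatorname{dom} f^*=\mathbb{R}^J$). (3) $C$ is a nonempty bounded closed (hence compact) subset of $U$. The Bregman distance is $D(x,y)=f(x)-f(y)-\langle\nabla f(y),x-y\rangle$ if $y\in U$, and $D(x,y)=+\infty$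 otherwise. For $y\in U$: $\overleftarrow{F}_C(y)=\sup_{x\in C}D(x,y)$ and $\overleftarrow{Q}_C(y)=\operatorname{argmax}_{x\in C}D(x,y)$ (set of maximizers). For a function $g$ finite and locally Lipschitz at $y$ and $w\in\mathbb{R}^J$, the Dini subderivative is $\mathrm{d}g(y)(w)=\liminf_{t\downarrow0}\frac{g(y+tw)-g(y)}{t}$ and the Clarke subderivative is $\hat{\mathrm{d}}g(y)(w)=\limsup_{x\to y,\,t\downarrow0}\frac{g(x+tw)-g(x)}{t}$. The Dini subdifferential is $\hat\partial g(y)=\{y^*\in\mathbb{R}^J : \langle y^*,w\rangle\le \mathrm{d}g(y)(w)\ \forall w\in\mathbb{R}^J\}$, the Clarke subdifferential is $\overline{\partial}g(y)=\{y^*\in\mathbb{R}^J : \langle y^*,w\rangle\le\hat{\mathrm{d}}g(y)(w)\ \forall w\in\mathbb{R}^J\}$, and the limiting subdifferential is $\partial_L g(y)=\limsup_{x\to y}\hat\partial g(x)$, i.e., the set of all limits of sequences $v_n\in\hat\partial g(x_n)$ with $x_n\to y$. $g$ is Clarke regular at $y$ if $\mathrm{d}g(y)(w)=\hat{\mathrm{d}}g(y)(w)$ for every $w\in\mathbb{R}^J$. *)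

(* Defs.v *)
From HB Require Import structures.
From mathcomp Require Export all_boot all_order all_algebra.
From mathcomp Require Export all_classical all_reals all_analysis.
Export Order.TTheory GRing.Theory Num.Theory.
Export numFieldNormedType.Exports.

Set Implicit Arguments.
Unset Strict Implicit.
Unset Printing Implicit Defensive.

Local Open Scope classical_set_scope.
Local Open Scope ring_scope.

(* R^J is 'rV[R]_J.  Its topology in the library comes from the sup norm `|x|,
   and coincides with the Euclidean one; wherever a norm itself occurs below,
   it is the Euclidean norm [enorm]. *)
Definition dot (R : realType) (J : nat) (u v : 'rV[R]_J) : R :=
  \sum_(j < J) u 0 j * v 0 j.

Definition enorm (R : realType) (J : nat) (u : 'rV[R]_J) : R :=
  Num.sqrt (dot u u).

Definition conv (R : realType) (J : nat) (A : set 'rV[R]_J) : set 'rV[R]_J :=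
  smallest (@convex_set R 'rV[R]_J) A.

Definition is_max (R : realType) (A : set R) (m : R) : Prop :=
  A m /\ ubound A m.

Section ExtendedRealFunctions.
Context {R : realType} {J : nat}.
Implicit Types (f g : 'rV[R]_J -> \bar R) (x y v w : 'rV[R]_J).

Definition dom f : set 'rV[R]_J := [set x | (f x < +oo)%E].

Definition intdom f : set 'rV[R]_J := (dom f)°.

Definition proper f : Prop := (forall x, f x != -oo%E) /\ dom f !=set0.

Definition econvex f : Prop := forall x y (t : R), 0 < t < 1 ->
  (f (t *: x + (1 - t) *: y)%R <= t%:E * f x + (1 - t)%R%:E * f y)%E.

Definition strictly_convex_on (S : set 'rV[R]_J) f : Prop :=
  forall x y (t : R), S x -> S y -> x != y -> 0 < t < 1 ->
  (f (t *: x + (1 - t) *: y)%R < t%:E * f x + (1 - t)%R%:E * f y)%E.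

(* The subdifferential of convex analysis. *)
Definition subdifferential f x : set 'rV[R]_J :=
  [set v | f x \is a fin_num /\
           forall z, (f x + (dot v (z - x)%R)%:E <= f z)%E].

Definition dom_subdifferential f : set 'rV[R]_J :=
  [set x | subdifferential f x !=set0].

(* [fine \o f] agrees with f on a neighbourhood of every point of [intdom f]
   (for proper f); [gradient] and [hessian] are meaningful there only. *)
Definition gradient f y : 'rV[R]_J :=
  \row_(j < J) 'D_(delta_mx 0 j) (fine \o f) y.

(* Vectors are rows: the Hessian of f at y sends v to [v *m hessian f y], the
   derivative of the gradient at y in the direction v. *)
Definition hessian f y : 'M[R]_J := jacobian (gradient f) y.

Definition essentially_smooth f : Prop :=
  [/\ intdom f !=set0,
      forall y, intdom f y -> differentiable (fine \o f) y &
      forall (u : nat -> 'rV[R]_J) (b : 'rV[R]_J),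
        (forall n, intdom f (u n)) ->
        (closure (intdom f) `\` (intdom f)°) b ->
        u n @[n --> \oo] --> b ->
        enorm (gradient f (u n)) @[n --> \oo] --> +oo].

Definition essentially_strictly_convex f : Prop :=
  forall S : set 'rV[R]_J,
    convex_set S -> S `<=` dom_subdifferential f -> strictly_convex_on S f.

Definition convex_legendre f : Prop :=
  [/\ proper f, lower_semicontinuous f, econvex f,
      essentially_smooth f & essentially_strictly_convex f].

Definition one_coercive f : Prop :=
  forall A : R, exists M : R, forall x, M < enorm x ->
    (A%:E < f x * ((enorm x)^-1)%:E)%E.

Definition twice_continuously_differentiable f (U : set 'rV[R]_J) : Prop :=
  forall y, U y -> [/\ differentiable (fine \o f) y,
                       differentiable (gradient f) y &
                       {for y, continuous (hessian f)}].

Definition bregman f x y : \bar R :=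
  if y \in intdom f then (f x - f y - (dot (gradient f y) (x - y)%R)%:E)%E
  else +oo%E.

Definition left_farthest_dist f (C : set 'rV[R]_J) y : \bar R :=
  ereal_sup [set bregman f x y | x in C].

Definition left_farthest_points f (C : set 'rV[R]_J) y : set 'rV[R]_J :=
  [set x | C x /\ forall z, C z -> (bregman f z y <= bregman f x y)%E].

Definition finite_locally_lipschitz_at g y : Prop :=
  exists K : R, \forall a & b \near y,
    [/\ g a \is a fin_num, g b \is a fin_num &
        `|fine (g a) - fine (g b)| <= K * enorm (a - b)].

(* The Dini and Clarke notions at y are meant for g finite and locally
   Lipschitz at y, i.e. with finite values near y. *)
Definition dini_subderivative g y w : \bar R :=
  limf_einf (fun t : R => (g (y + t *: w)%R - g y) * (t^-1)%:E)%E (0^'+).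

Definition clarke_subderivative g y w : \bar R :=
  limf_esup (fun p : 'rV[R]_J * R =>
               (g (p.1 + p.2 *: w)%R - g p.1) * (p.2^-1)%:E)%E
            (filter_prod (nbhs y) (0^'+)).

Definition dini_subdifferential g y : set 'rV[R]_J :=
  [set v | forall w, ((dot v w)%:E <= dini_subderivative g y w)%E].

Definition clarke_subdifferential g y : set 'rV[R]_J :=
  [set v | forall w, ((dot v w)%:E <= clarke_subderivative g y w)%E].

Definition limiting_subdifferential g y : set 'rV[R]_J :=
  [set v | exists (x_ v_ : nat -> 'rV[R]_J),
     [/\ x_ n @[n --> \oo] --> y,
         v_ n @[n --> \oo] --> v &
         forall n, dini_subdifferential g (x_ n) (v_ n)]].

Definition clarke_regular_at g y : Prop :=
  finite_locally_lipschitz_at g y /\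
  forall w, dini_subderivative g y w = clarke_subderivative g y w.

End ExtendedRealFunctions.

(* Main.v *)
(* On U the Bregman distance is D(x,y) = f x - f y - <grad f y, x - y>, jointly
   continuous in (x,y), with y-gradient (y - x) Hess f(y) because the Hessian is
   symmetric.  Hence the farthest distance is a maximum over the compact set C
   of functions which are continuously differentiable in y, uniformly in x, and
   Danskin's argument applies: testing with a maximizer at y bounds the Dini
   subderivative from below, while testing with a maximizer at z + tw, the mean
   value theorem and compactness of C bound the Clarke subderivative from above
   by the same maximum of slopes.  The three subdifferentials thus have the same
   support function; the convex hull of the compact set of maximizers is compact
   by Caratheodory, so separation identifies them with its affine image. *)

Require Import Defs.
From mathcomp Require Import ring lra.

Set Implicit Arguments.
Unset Strict Implicit.
Unset Printing Implicit Defensive.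

Local Open Scope classical_set_scope.
Local Open Scope ring_scope.

(** * Continuity of matrix entries, finite sums and the inner product *)

Lemma continuous_entry (T : topologicalType) m n i j :
  continuous (fun M : 'M[T]_(m, n) => M i j).
Proof.
move=> M V MV; exists (fun i' j' => if (i', j') == (i, j) then V else setT).
  by move=> i' j'; case: eqP => [[-> ->]//|_]; exact: filterT.
by move=> N /(_ i j); rewrite eqxx.
Qed.

Lemma cvg_sumr (R : realType) (V : normedModType R) (T I : Type)
    (F : set_system T) {FF : Filter F} (r : seq I) (f : I -> T -> V)
    (a : I -> V) :
  (forall i, f i x @[x --> F] --> a i) ->
  \sum_(i <- r) f i x @[x --> F] --> \sum_(i <- r) a i.
Proof.
by move=> fa; apply: cvg_big => [|i _]; [exact: add_continuous|exact: fa].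
Qed.

Section Dot.
Context {R : realType} {J : nat}.
Implicit Types u v w : 'rV[R]_J.

Lemma dotE u v : dot u v = (u *m v^T) 0 0.
Proof. by rewrite mxE; apply: eq_bigr => j _; rewrite mxE. Qed.

Lemma dotC u v : dot u v = dot v u.
Proof. by apply: eq_bigr => j _; rewrite mulrC. Qed.

Lemma dotDl u v w : dot (u + v) w = dot u w + dot v w.
Proof. by rewrite !dotE mulmxDl mxE. Qed.

Lemma dotNl u w : dot (- u) w = - dot u w.
Proof. by rewrite !dotE mulNmx mxE. Qed.

Lemma dotBl u v w : dot (u - v) w = dot u w - dot v w.
Proof. by rewrite dotDl dotNl. Qed.

Lemma dotZl a u w : dot (a *: u) w = a * dot u w.
Proof. by rewrite !dotE -scalemxAl mxE. Qed.

Lemma dotDr w u v : dot w (u + v) = dot w u + dot w v.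
Proof. by rewrite dotC dotDl !(dotC w). Qed.

Lemma dotNr w u : dot w (- u) = - dot w u.
Proof. by rewrite dotC dotNl dotC. Qed.

Lemma dotBr w u v : dot w (u - v) = dot w u - dot w v.
Proof. by rewrite dotDr dotNr. Qed.

Lemma dotZr a w u : dot w (a *: u) = a * dot w u.
Proof. by rewrite dotC dotZl dotC. Qed.

Lemma dot_ge0 u : 0 <= dot u u.
Proof. by apply: sumr_ge0 => j _; rewrite -expr2 sqr_ge0. Qed.

Lemma dot_le0_eq0 u : dot u u <= 0 -> u = 0.
Proof.
move=> u0; have /eqP : dot u u = 0 by apply/eqP; rewrite eq_le u0 dot_ge0.
rewrite psumr_eq0 => [/allP u_eq0|j _]; last by rewrite -expr2 sqr_ge0.
apply/rowP => j; rewrite mxE; apply/eqP.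
by have := u_eq0 j (mem_index_enum _); rewrite /= -expr2 sqrf_eq0.
Qed.

Lemma coord_le_enorm u j : `|u 0 j| <= enorm u.
Proof.
rewrite -sqrtr_sqr ler_wsqrtr// /dot (bigD1 j)//= -expr2 lerDl.
by apply: sumr_ge0 => i _; rewrite -expr2 sqr_ge0.
Qed.

(** A coordinatewise bound, cruder than Cauchy-Schwarz, but enough to produce a Lipschitz constant
    in the Euclidean norm. *)
Lemma ler_norm_dot u w : `|dot u w| <= (\sum_j `|u 0 j|) * enorm w.
Proof.
rewrite mulr_suml (le_trans (ler_norm_sum _ _ _))// ler_sum// => j _.
by rewrite normrM ler_wpM2l// coord_le_enorm.
Qed.

Lemma coord_le_norm u j : `|u 0 j| <= `|u|.
Proof.
rewrite -[leRHS]/(mx_norm u) mx_normrE.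
by apply/bigmax_geP; right => /=; exists (0, j).
Qed.

(** Variant for the sup norm, in which the remainder of a first-order expansion is measured. *)
Lemma ler_norm_dot_sup u w : `|dot u w| <= (\sum_j `|w 0 j|) * `|u|.
Proof.
rewrite dotC mulr_suml (le_trans (ler_norm_sum _ _ _))// ler_sum// => j _.
by rewrite normrM ler_wpM2l// coord_le_norm.
Qed.

Lemma cvg_dot (T : Type) (F : set_system T) {FF : Filter F}
    (a b : T -> 'rV[R]_J) u v :
  a @ F --> u -> b @ F --> v -> dot (a x) (b x) @[x --> F] --> dot u v.
Proof.
move=> au bv; apply: (@cvg_sumr R R) => j; apply: cvgM.
- exact: (cvg_comp _ _ au (@coord_continuous _ _ _ 0 j u)).
- exact: (cvg_comp _ _ bv (@coord_continuous _ _ _ 0 j v)).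
Qed.

Lemma cvg_mulmx (T : Type) (F : set_system T) {FF : Filter F}
    (a : T -> 'rV[R]_J) (M : T -> 'M[R]_J) u N :
  a @ F --> u -> M @ F --> N -> a x *m M x @[x --> F] --> u *m N.
Proof.
move=> au MN; apply/cvg_ballP => e e0.
have cij (j : 'I_J) : (a x *m M x) 0 j @[x --> F] --> (u *m N) 0 j.
  rewrite mxE (_ : (fun x => _) = fun x => \sum_i a x 0 i * M x i j); last first.
    by apply/funext => x; rewrite mxE.
  apply: (@cvg_sumr R R) => i; apply: cvgM.
  - exact: (cvg_comp _ _ au (@coord_continuous _ _ _ 0 i u)).
  - exact: (cvg_comp _ _ MN (@coord_continuous _ _ _ i j N)).
have : \forall x \near F, forall j, ball ((u *m N) 0 j) e ((a x *m M x) 0 j).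
  by apply: filter_forall => j; have /cvg_ballP := cij j; apply.
by apply: filterS => x Hx; split=> // i j; rewrite ord1; exact: Hx.
Qed.

End Dot.

(** * Convex hulls of compact sets *)

Section ConvexHull.
Context {R : realType} {J : nat}.
Implicit Types (A : set 'rV[R]_J) (v w : 'rV[R]_J).

Definition combinations A n : set 'rV[R]_J :=
  [set v | exists (l : 'I_n -> R) (X : 'I_n -> 'rV[R]_J),
    [/\ forall i, 0 <= l i, \sum_i l i = 1, forall i, A (X i) &
        v = \sum_i l i *: X i]].

Lemma convex_setP (A : set 'rV[R]_J) :
  @convex_set R 'rV[R]_J A <-> forall x y (t : R), A x -> A y ->
    0 <= t -> t <= 1 -> A (t *: x + (1 - t) *: y).
Proof.
split=> [cA x y t Ax Ay t0 t1|cA x y t /set_mem Ax /set_mem Ay].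
  have t01 : Itv.spec (@Itv.num_sem R) (Itv.Real `[0%Z, 1%Z]) t.
    by rewrite /= /Itv.num_sem num_real/= in_itv/= t0.
  have := cA x y (Itv.mk t01) (mem_set Ax) (mem_set Ay).
  by move=> /set_mem.
by apply/mem_set/cA.
Qed.

Lemma conv_convex A : @convex_set R 'rV[R]_J (conv A).
Proof.
apply/convex_setP => x y t Ax Ay t0 t1 B [cB AB].
by move/convex_setP: (cB); apply => //; [exact: Ax|exact: Ay].
Qed.

Lemma sub_conv A : A `<=` conv A.
Proof. by move=> x Ax B [_]; apply. Qed.

Lemma conv_min A (B : set 'rV[R]_J) :
  @convex_set R 'rV[R]_J B -> A `<=` B -> conv A `<=` B.
Proof. by move=> cB AB x; apply. Qed.

(** Induction on the number of points: the first point is split off and the remaining weights are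
    divided by their sum [1 - l ord0]; when this sum is 0, only the first point remains. *)
Lemma combinations_conv A n : combinations A n `<=` conv A.
Proof.
elim: n => [|n IH] v [l [X [l0 l1 AX ->]]].
  by move: l1; rewrite big_ord0 => /esym/eqP; rewrite oner_eq0.
rewrite big_ord_recl; rewrite big_ord_recl in l1.
have [l01|l01] := eqVneq (l ord0) 1.
  have /eqP : \sum_(i < n) l (lift ord0 i) = 0 by move: l1; rewrite l01; lra.
  rewrite psumr_eq0// => /allP li0.
  rewrite l01 scale1r big1 ?addr0; first exact: sub_conv.
  by move=> i _; have /eqP -> := li0 i (mem_index_enum _); rewrite scale0r.
have s0 : 1 - l ord0 != 0 by rewrite subr_eq0 eq_sym.
have sE : \sum_(i < n) l (lift ord0 i) = 1 - l ord0 by rewrite -l1 addrC addKr.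
have s_ge0 : 0 <= 1 - l ord0 by rewrite -sE sumr_ge0.
have -> : \sum_(i < n) l (lift ord0 i) *: X (lift ord0 i) =
    (1 - l ord0) *: \sum_(i < n) (l (lift ord0 i) / (1 - l ord0)) *:
      X (lift ord0 i).
  rewrite scaler_sumr; apply: eq_bigr => i _.
  by rewrite scalerA mulrC divfK.
have /convex_setP := @conv_convex A; apply => //.
- exact: sub_conv.
- apply: IH; exists (fun i => l (lift ord0 i) / (1 - l ord0)).
  exists (fun i => X (lift ord0 i)); split => //.
  + by move=> i; rewrite divr_ge0.
  + by rewrite -mulr_suml sE divff.
- by rewrite -subr_ge0.
Qed.

(** By minimality of the hull: finite combinations form a convex set, since two families can be
    concatenated with weights scaled by [t] and [1 - t]. *)
Lemma conv_combinations A v : conv A v -> exists n, combinations A n v.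
Proof.
move: v; apply: conv_min; last first.
  move=> x Ax; exists 1%N, (fun=> 1), (fun=> x).
  by rewrite !big_ord1 scale1r; split.
apply/convex_setP => x y t [n [l [X [l0 l1 AX ->]]]] [m [k [Y [k0 k1 AY ->]]]].
move=> t0 t1; exists (n + m)%N.
have splitl i : fintype.split (lshift m i) = inl i := unsplitK (inl i).
have splitr i : fintype.split (rshift n i) = inr i := unsplitK (inr i).
exists (fun i : 'I_(n + m) => match fintype.split i with inl i => t * l i
                                  | inr j => (1 - t) * k j end).
exists (fun i : 'I_(n + m) => match fintype.split i with
  inl i => X i | inr j => Y j end).
split.
- by move=> i; case: splitP => j _; rewrite mulr_ge0// subr_ge0.
- rewrite big_split_ord/= -[RHS](addrNK t) addrC; congr (_ + _).
    under eq_bigr do rewrite splitr.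
    by rewrite -mulr_sumr k1 mulr1.
  under eq_bigr do rewrite splitl.
  by rewrite -mulr_sumr l1 mulr1.
- by move=> i; case: splitP.
- rewrite big_split_ord/= !scaler_sumr; congr (_ + _).
    by apply: eq_bigr => i _; rewrite splitl scalerA.
  by apply: eq_bigr => i _; rewrite splitr scalerA.
Qed.

(** Padding by a point of weight 0. The padding point must lie in [A], so an existing one, [X ord0],
    is repeated; hence the start at [n.+1]. *)
Lemma combinationsS A n : combinations A n.+1 `<=` combinations A n.+2.
Proof.
move=> v [l [X [l0 l1 AX ->]]].
exists (fun i => if unlift ord0 i is Some j then l j else 0).
exists (fun i => if unlift ord0 i is Some j then X j else X ord0); split.
- by move=> i; case: unliftP.
- rewrite big_ord_recl unlift_none add0r -[RHS]l1.
  by apply: eq_bigr => i _; rewrite liftK.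
- by move=> i; case: unliftP.
- rewrite [RHS]big_ord_recl unlift_none scale0r add0r.
  by apply: eq_bigr => i _; rewrite liftK.
Qed.

(* Caratheodory's reduction: the n+1 > J+1 rows (X_i, 1) are linearly
   dependent; subtracting the largest admissible multiple of a dependency
   relation cancels one weight and keeps the others nonnegative. *)
Lemma combinations_reduce A n : (J < n)%N ->
  combinations A n.+1 `<=` combinations A n.
Proof.
move=> Jn v [l [X [l0 l1 AX ->]]].
pose M : 'M[R]_(n.+1, J + 1) :=
  row_mx (\matrix_(i, j) X i 0 j) (const_mx 1).
have : kermx M != 0.
  rewrite kermx_eq0 -row_leq_rank -ltnNge (leq_ltn_trans (rank_leq_col _))//.
  by rewrite addn1.
case/rowV0Pn => u /sub_kermxP; rewrite mul_mx_row.
move=> /(fun e => etrans e (esym (@row_mx0 _ _ _ _))) /eq_row_mx[uX u1] u_neq0.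
have {}u1 : \sum_i u 0 i = 0.
  have /rowP/(_ ord0) := u1; rewrite !mxE; apply: etrans.
  by apply: eq_bigr => i _; rewrite mxE mulr1.
have {}uX : \sum_i u 0 i *: X i = 0.
  apply: etrans uX; apply/rowP => j; rewrite summxE mxE.
  by apply: eq_bigr => i _; rewrite !mxE.
(* The entries of [u] sum to 0 and do not all vanish, so one is positive and the minimum ratio below
   ranges over a nonempty set. *)
have [i0 ui0] : exists i, 0 < u 0 i.
  apply/not_existsP => u_le0; move/eqP: u_neq0; apply; apply/rowP => i.
  have ule i' : 0 <= - u 0 i' by rewrite oppr_ge0 leNgt; apply/negP/u_le0.
  have /eqP : \sum_i - u 0 i = 0 by rewrite sumrN u1 oppr0.
  rewrite psumr_eq0// => /allP/(_ i (mem_index_enum _)).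
  by rewrite oppr_eq0 => /eqP; rewrite mxE.
case: (@arg_minP _ _ _ i0 (fun i => 0 < u 0 i) (fun i => l i / u 0 i) ui0).
move=> k uk kmin.
set c := l k / u 0 k in kmin.
have c_ge0 : 0 <= c by rewrite divr_ge0// ltW.
pose l' i := l i - c * u 0 i.
have l'k : l' k = 0 by rewrite /l' /c divfK ?subrr// gt_eqF.
have l'sum : \sum_i l' i = 1 by rewrite sumrB -mulr_sumr u1 mulr0 subr0.
have l'X : \sum_i l i *: X i = \sum_i l' i *: X i.
  under [RHS]eq_bigr do rewrite scalerBl -scalerA.
  by rewrite sumrB -scaler_sumr uX scaler0 subr0.
exists (l' \o lift k), (X \o lift k); split.
- move=> i /=; rewrite /l' subr_ge0; set j := lift k i.
  (* For a positive entry, minimality of the ratio [c] keeps the new weight nonnegative; otherwise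
     [c * u 0 j] is already nonpositive. *)
  have [uj|uj] := ltP 0 (u 0 j); first by rewrite -ler_pdivlMr// kmin.
  by rewrite (le_trans _ (l0 j))// mulr_ge0_le0.
- by rewrite -l'sum (bigD1_ord k)//= l'k add0r.
- by move=> i; exact: AX.
- by rewrite l'X (bigD1_ord k)//= l'k scale0r add0r.
Qed.

(** A combination of any length is padded up or reduced down to length exactly [J.+1]; length 0 is
    excluded because the weights sum to 1. A fixed length is what the compactness argument
    requires. *)
Lemma conv_caratheodory A : conv A = combinations A J.+1.
Proof.
apply/seteqP; split=> [v /conv_combinations[n]|]; last exact: combinations_conv.
have [n_le|/ltnW J_le] := leqP n J.+1.
  case: n n_le => [_ [l [X [_]]]|n nJ].
    by rewrite big_ord0 => /esym/eqP; rewrite oner_eq0.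
  rewrite -(subnK nJ); elim: (_ - _)%N => [//|k IH] /IH.
  by rewrite addSn addnS; exact: combinationsS.
rewrite -(subnK J_le); elim: (_ - _)%N => [//|k IH].
rewrite addSn => /combinations_reduce Hv; apply: IH; apply: Hv.
by rewrite addnS ltnS leq_addl.
Qed.

(** The hull is the continuous image of the product of the standard simplex [S] and the set [B] of
    families of [J.+1] points of [A], both compact. *)
Lemma conv_compact A : compact A -> compact (conv A).
Proof.
move=> cA; rewrite conv_caratheodory; set n := J.+1.
pose S := [set l : 'rV[R]_n | (forall i, `[0, 1]%classic (l ord0 i)) ] `&`
          [set l | \sum_i l 0 i = 1].
pose B := [set X : 'rV['rV[R]_J]_n | forall i, A (X ord0 i)].
have cS : compact S.
  apply: compact_closedI.
    apply: (@rV_compact R n (fun=> `[0, 1]%classic)) => i.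
    exact: segment_compact.
  apply: (@preimage_closed _ _ (fun l : 'rV[R]_n => \sum_i l 0 i) [set x | x = 1]).
    move=> l _; apply: (@cvg_sumr R R _ _ (nbhs l)) => i; exact: coord_continuous.
  exact: closed_eq.
have cB : compact B by apply: (@rV_compact _ n (fun=> A)).
pose f (q : 'rV[R]_n * 'rV['rV[R]_J]_n) := \sum_i q.1 0 i *: q.2 0 i.
have -> : combinations A n = f @` (S `*` B).
  apply/seteqP; split=> [v [l [X [l0 l1 AX ->]]]|_ [[l X] [[/= l0 l1] AX] <-]].
    exists (\row_i l i, \row_i X i); last first.
      by apply: eq_bigr => i _; rewrite !mxE.
    split=> /=; last by move=> i; rewrite mxE.
    split=> [i|/=]; last by rewrite -[RHS]l1; apply: eq_bigr => i _; rewrite mxE.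
    rewrite /= mxE in_itv/= l0/= -l1 (bigD1 i)//= lerDl.
    by rewrite sumr_ge0.
  exists (fun i => l 0 i), (fun i => X 0 i); split=> // i.
  by have := l0 i; rewrite /= in_itv/= => /andP[].
apply: continuous_compact; last exact: compact_setX.
apply: continuous_subspaceT => -[l X]; apply: cvg_sumr => i; apply: cvgZ.
  exact: (@cvg_comp _ _ _ fst (fun M : 'rV[R]_n => M 0 i) (nbhs (l, X))
    (nbhs l) _ cvg_fst (@continuous_entry _ _ _ _ _ l)).
exact: (@cvg_comp _ _ _ snd (fun M : 'rV['rV[R]_J]_n => M 0 i) (nbhs (l, X))
  (nbhs X) _ cvg_snd (@continuous_entry _ _ _ _ _ X)).
Qed.

(* If v is not in K, the projection of v onto K gives a separating w. *)
Lemma mem_compact_convex (K : set 'rV[R]_J) v :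
  K !=set0 -> compact K -> @convex_set R 'rV[R]_J K ->
  (forall w, exists2 x, K x & dot v w <= dot x w) -> K v.
Proof.
move=> K0 cK /convex_setP cvxK vK.
have [x|x /set_mem Kx xmin] :=
    @compact_EVT_min _ _ (fun x : 'rV[R]_J => dot (x - v) (x - v)) _ K0 cK.
  apply: continuous_subspaceT => {}x.
  have xv : z - v @[z --> x] --> x - v.
    exact: (@cvgB _ _ _ (nbhs x) _ id (cst v) _ _ cvg_id (cvg_cst v)).
  exact: (cvg_dot xv xv).
(* Here [x] is the projection of [v] onto [K]. Testing in direction [v - x] yields a point [z] which
   contradicts the variational inequality of the projection unless [v = x]. *)
have [z Kz] := vK (v - x).
suff zx : dot (z - x) (v - x) <= 0.
  move=> vz; suff /dot_le0_eq0/eqP : dot (v - x) (v - x) <= 0.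
    by rewrite subr_eq0 => /eqP ->.
  by move: vz zx; rewrite !dotBl; lra.
set D := dot (z - x) (v - x).
set N := dot (z - x) (z - x).
(* Minimality of [x] compared with the point at parameter [t] on the segment from [x] to [z],
   squares expanded. *)
have step (t : R) : 0 <= t -> t <= 1 -> 2 * t * D <= t ^+ 2 * N.
  move=> t0 t1; have := xmin _ (mem_set (cvxK _ _ _ Kz Kx t0 t1)).
  have -> : t *: z + (1 - t) *: x - v = t *: (z - x) - (v - x).
    by apply/rowP => j; rewrite !mxE; ring.
  rewrite -(opprB v x) dotNl dotNr opprK.
  rewrite /D /N; move: (z - x) (v - x) => a b.
  rewrite dotBl !dotBr !dotZl !dotZr (dotC b a).
  by lra.
rewrite leNgt; apply/negP => D0.
have N0 : 0 <= N := dot_ge0 _.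
have DN : 0 < D + N by lra.
(* With this [t], [t * N = D - t * D < D], whereas [step] divided by [t] gives [2 * D <= t * N]. *)
set t := D / (D + N).
have t0 : 0 < t by rewrite divr_gt0.
have t1 : t <= 1 by rewrite ler_pdivrMr// mul1r lerDl.
have tE : t * (D + N) = D by rewrite divfK// gt_eqF.
have tD : 0 < t * D by rewrite mulr_gt0.
have : 2 * D <= t * N by rewrite -(ler_pM2l t0); move: (step t (ltW t0) t1); lra.
lra.
Qed.

End ConvexHull.

(** * Mean value theorem and symmetry of second derivatives *)

Section MeanValue.
Context {R : realType} {V : normedModType R}.

Lemma is_derive_translate (W : normedModType R) (f : V -> W) (c z w : V) df :
  is_derive (z + c) w f df -> is_derive z w (fun x => f (x + c)) df.
Proof.
case=> exf dfE.
have E : (fun h : R => h^-1 *: ((f \o shift (z + c)) (h *: w) - f (z + c))) =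
    (fun h => h^-1 *: (((fun x => f (x + c)) \o shift z) (h *: w) - f (z + c))).
  by apply/funext => h /=; rewrite addrA.
split; first by move: exf; rewrite /derivable E.
by rewrite -dfE /derive E.
Qed.

Lemma is_derive_line (W : normedModType R) (f : V -> W) (b w : V) (s : R) df :
  is_derive (b + s *: w) w f df -> is_derive s 1 (fun t => f (b + t *: w)) df.
Proof.
case=> exf dfE.
have E : (fun h : R => h^-1 *: ((f \o shift (b + s *: w)) (h *: w) -
      f (b + s *: w))) =
    (fun h => h^-1 *: (((fun t => f (b + t *: w)) \o shift s) (h *: 1) -
      f (b + s *: w))).
  by apply/funext => h /=; rewrite scalerDl -scalerA scale1r addrCA.
split; first by move: exf; rewrite /derivable E.
by rewrite -dfE /derive E.
Qed.

Lemma mean_value (f : V -> R) (df : V -> R) (b w : V) :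
  (forall s : R, 0 <= s -> s <= 1 ->
    is_derive (b + s *: w) w f (df (b + s *: w))) ->
  exists s : R, [/\ 0 <= s, s <= 1 & f (b + w) - f b = df (b + s *: w)].
Proof.
move=> Hdf.
have Hs (s : R) : 0 <= s -> s <= 1 ->
    is_derive s 1 (fun t => f (b + t *: w)) (df (b + s *: w)).
  by move=> s0 s1; apply/is_derive_line/Hdf.
have [||s] :=
  @MVT R (fun s => f (b + s *: w)) (fun s => df (b + s *: w)) 0 1 ltr01.
- by move=> s; rewrite in_itv/= => /andP[/ltW s0 /ltW s1]; exact: Hs.
- apply: derivable_within_continuous => s; rewrite in_itv/= => /andP[s0 s1].
  by have [] := Hs s s0 s1.
rewrite in_itv/= => /andP[/ltW s0 /ltW s1].
by rewrite scale1r scale0r addr0 subr0 mulr1 => E; exists s.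
Qed.

Lemma differentiable_approx (W : normedModType R) (f : V -> W) (x : V) (e : R) :
  0 < e -> differentiable f x ->
  \forall h \near 0, `|f (x + h) - f x - 'd f x h| <= e * `|h|.
Proof.
move=> e0 /diff_locally/eqaddoP/(_ _ e0).
apply: filterS => h.
have -> : (f \o shift x - (cst (f x) + 'd f x)) h = f (h + x) - (f x + 'd f x h).
  by [].
by rewrite opprD addrA (addrC h).
Qed.

End MeanValue.

Section Schwarz.
Context {R : realType} {J : nat}.
Implicit Types u w y : 'rV[R]_J.

(* The mean value theorem in the direction u, then the first-order expansion
   of the gradient g at y. *)
Lemma second_difference (phi : 'rV[R]_J -> R) (g : 'rV[R]_J -> 'rV[R]_J)
    y u w (e : R) : 0 < e ->
  (\forall z \near y, forall v, is_derive z v phi (dot (g z) v)) ->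
  differentiable g y ->
  \forall s \near 0^'+, `|phi (y + s *: u + s *: w) - phi (y + s *: u)
    - phi (y + s *: w) + phi y - s ^+ 2 * dot ('d g y w) u| <= e * s ^+ 2.
Proof.
move=> e0 dphi dg.
(* [K] bounds the pairing with [u]; [s * L] exceeds the sum of the bounds on the two increments met
   below; [d] is the accuracy of the expansion of [g] that makes the total error at most
   [e * s ^+ 2]. The added units keep the denominators positive. *)
pose K := \sum_j `|u 0 j|; pose L := (`|u| + `|w|) + `|u| + 1.
have K0 : 0 <= K by apply: sumr_ge0.
have L0 : 0 < L by rewrite ltr_wpDl// !addr_ge0.
pose d := e / ((K + 1) * L).
have d0 : 0 < d by rewrite divr_gt0// mulr_gt0// ltr_wpDl.
have /nbhs_ballP[r /= r0 Hr] : \forall h \near nbhs (0 : 'rV[R]_J),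
    (forall v, is_derive (y + h) v phi (dot (g (y + h)) v)) /\
    `|g (y + h) - g y - 'd g y h| <= d * `|h|.
  have A2 := differentiable_approx d0 dg.
  suff A1 : \forall h \near nbhs (0 : 'rV[R]_J),
      forall v, is_derive (y + h) v phi (dot (g (y + h)) v).
    by near=> h; split; [near: h; exact: A1|near: h; exact: A2].
  have yh : y + h @[h --> (0 : 'rV[R]_J)] --> y.
    rewrite -[X in _ --> X]addr0.
    exact: (cvgD (cvg_cst y) (@cvg_id _ (nbhs (0 : 'rV[R]_J)))).
  exact: yh dphi.
have {}Hr (h : 'rV[R]_J) : `|h| < r ->
    (forall v, is_derive (y + h) v phi (dot (g (y + h)) v)) /\
    `|g (y + h) - g y - 'd g y h| <= d * `|h|.
  by move=> hr; apply: Hr; rewrite -ball_normE /= sub0r normrN.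
near=> s.
have s0 : 0 < s by near: s; exact: nbhs_right_gt.
have s_lt : s < r / L by near: s; apply: nbhs_right_lt; rewrite divr_gt0.
have {s_lt}sL : s * L < r by rewrite -ltr_pdivlMr.
have sU : `|s *: u| = s * `|u| by rewrite normrZ gtr0_norm.
have sW : `|s *: w| = s * `|w| by rewrite normrZ gtr0_norm.
have norm_cu (c : R) : 0 <= c -> c <= 1 -> `|c *: (s *: u)| <= s * `|u|.
  by move=> c0 c1; rewrite normrZ sU ger0_norm// ler_piMl// mulr_ge0// ltW.
have [u0 w0] := (normr_ge0 u, normr_ge0 w).
have norm1 (c : R) : 0 <= c -> c <= 1 -> `|c *: (s *: u)| < r.
  move=> c0 c1; apply: le_lt_trans (norm_cu c c0 c1) (le_lt_trans _ sL).
  by rewrite ler_pM2l// /L; lra.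
have norm2 (c : R) : 0 <= c -> c <= 1 ->
    `|c *: (s *: u) + s *: w| <= s * (`|u| + `|w|).
  move=> c0 c1; rewrite (le_trans (ler_normD _ _))// sW mulrDr lerD2r.
  exact: norm_cu.
have norm2r (c : R) : 0 <= c -> c <= 1 -> `|c *: (s *: u) + s *: w| < r.
  move=> c0 c1; apply: le_lt_trans (norm2 c c0 c1) (le_lt_trans _ sL).
  by rewrite ler_pM2l// /L; lra.
(* The second difference is the increment along [s *: u] of the first difference in direction
   [s *: w]. *)
have [|c [c0 c1]] := @mean_value R 'rV[R]_J (fun z => phi (z + s *: w) - phi z)
    (fun z => dot (g (z + s *: w)) (s *: u) - dot (g z) (s *: u)) y (s *: u).
  move=> c c0 c1; apply: is_deriveB.
    apply: is_derive_translate; rewrite -addrA.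
    by have [+ _] := Hr _ (norm2r c c0 c1); apply.
  by have [+ _] := Hr _ (norm1 c c0 c1); apply.
pose h1 := c *: (s *: u) + s *: w; pose h2 := c *: (s *: u).
rewrite -(addrA y (c *: (s *: u))) -/h1 -/h2 => E.
have [_ E1] := Hr _ (norm2r c c0 c1); have [_ E2] := Hr _ (norm1 c c0 c1).
rewrite -/h1 in E1; rewrite -/h2 in E2.
(* As [h1 - h2 = s *: w], the linear parts at [h1] and [h2] differ by exactly the subtracted main
   term, and only the two remainders are left. *)
have -> : phi (y + s *: u + s *: w) - phi (y + s *: u) - phi (y + s *: w) + phi y
    - s ^+ 2 * dot ('d g y w) u
  = s * (dot (g (y + h1) - g y - 'd g y h1) u -
         dot (g (y + h2) - g y - 'd g y h2) u).
  have -> : phi (y + s *: u + s *: w) - phi (y + s *: u) - phi (y + s *: w) +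
      phi y = dot (g (y + h1)) (s *: u) - dot (g (y + h2)) (s *: u).
    by rewrite -E; ring.
  rewrite -dotBl dotZr expr2 -mulrA -mulrBr.
  congr (_ * _); rewrite -dotBl -dotZl -dotBl; congr dot.
  have -> : h1 = h2 + s *: w by [].
  have dgZ : 'd g y (s *: w) = s *: 'd g y w by rewrite linearZ.
  by rewrite linearD dgZ; apply/rowP => j; rewrite !mxE; ring.
rewrite normrM gtr0_norm// expr2 mulrCA ler_pM2l//.
rewrite (le_trans (ler_normB _ _))//.
have dK : d * (K + 1) * L = e.
  by rewrite /d -mulrA divfK// gt_eqF// mulr_gt0// ltr_wpDl.
apply: (@le_trans _ _ (K * (d * (s * (`|u| + `|w|))) + K * (d * (s * `|u|)))).
  apply: lerD; rewrite (le_trans (ler_norm_dot_sup _ _))// ler_wpM2l//.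
    by rewrite (le_trans E1)// ler_pM2l// norm2.
  by rewrite (le_trans E2)// ler_pM2l// norm_cu.
have -> : e * s = d * (K + 1) * L * s by rewrite dK.
clearbody d.
have dL0 : 0 <= d * L * s by rewrite !mulr_ge0 ?ltW.
have K1 : K * (d * L * s) <= (K + 1) * (d * L * s) by rewrite ler_wpM2r// lerDl.
have LE : L = `|u| + `|w| + `|u| + 1 by [].
have ds0 : 0 <= K * (d * s) by rewrite mulr_ge0// mulr_ge0 ?ltW.
move: K1 ds0; rewrite LE; lra.
Unshelve. all: by end_near. Qed.

(** The second difference is symmetric in [u] and [w], so its two approximations differ by at most
    [e * s ^+ 2]; dividing by [s ^+ 2] leaves an arbitrary [e]. *)
Lemma schwarz (phi : 'rV[R]_J -> R) (g : 'rV[R]_J -> 'rV[R]_J) y u w :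
  (\forall z \near y, forall v, is_derive z v phi (dot (g z) v)) ->
  differentiable g y -> dot ('d g y w) u = dot ('d g y u) w.
Proof.
move=> dphi dg; apply/eqP; rewrite -subr_eq0 -normr_le0.
apply/ler_addgt0Pl => e e0; rewrite addr0.
have e20 : 0 < e / 2 by rewrite divr_gt0.
have D1 := second_difference u w e20 dphi dg.
have D2 := second_difference w u e20 dphi dg.
have [s [s0 [H1 H2]]] := filter_ex (filterI (nbhs_right_gt 0) (filterI D1 D2)).
have s20 : 0 < s ^+ 2 by rewrite exprn_gt0.
rewrite -(ler_pM2l s20) -[X in X * `|_|]gtr0_norm// -normrM mulrBr.
rewrite (addrAC y (s *: w)) in H2.
rewrite (le_trans _ (_ : e / 2 * s ^+ 2 + e / 2 * s ^+ 2 <= _))//; last by lra.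
apply: le_trans (lerD H2 H1); apply: le_trans (ler_normB _ _).
by rewrite le_eqVlt; apply/orP; left; apply/eqP; congr (`|_|); ring.
Qed.

End Schwarz.

(** * Maxima of smooth families over a compact set *)

Section LimInfSup.
Context {R : realType} {X : topologicalType}.
Implicit Types (f : X -> \bar R) (F : set_system X).

Lemma limf_esup_le f F (a : \bar R) :
  (\forall t \near F, (f t <= a)%E) -> (limf_esup f F <= a)%E.
Proof.
move=> fa; apply: ge_ereal_inf; exists (ereal_sup (f @` [set t | (f t <= a)%E])).
  by exists [set t | (f t <= a)%E].
by apply: ge_ereal_sup => _ [t /= fta <-].
Qed.

Lemma limf_einf_ge f F (a : \bar R) :
  (\forall t \near F, (a <= f t)%E) -> (a <= limf_einf f F)%E.
Proof.
move=> fa; rewrite limf_einfE; apply: le_ereal_sup_tmp.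
exists (ereal_inf (f @` [set t | (a <= f t)%E])).
  by exists [set t | (a <= f t)%E].
by apply: le_ereal_inf_tmp => _ [t /= fta <-].
Qed.

End LimInfSup.

(** The pairs [(y, t)] with small [t] meet every set of the product filter, so each infimum on the
    left shares a quotient with each supremum on the right. *)
Lemma dini_le_clarke (R : realType) (J : nat) (g : 'rV[R]_J -> \bar R)
  (y w : 'rV[R]_J) : (dini_subderivative g y w <= clarke_subderivative g y w)%E.
Proof.
rewrite /dini_subderivative limf_einfE; apply: ge_ereal_sup => _ [V V0 <-].
apply: le_ereal_inf_tmp => _ [W [[A B]/= [Ay B0] AB] <-].
have [t [Vt Bt]] := filter_ex (filterI V0 B0).
apply: le_trans (ereal_inf_lbound _) (ereal_sup_ubound _); first by exists t.
by exists (y, t) => //; apply: AB; split=> //=; exact: nbhs_singleton.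
Qed.

Lemma ball_segment (R : realType) (V : normedModType R) (y a b : V) (r s : R) :
  ball y r a -> ball y r b -> 0 <= s -> s <= 1 -> ball y r (b + s *: (a - b)).
Proof.
rewrite -ball_normE /= => ya yb s0 s1.
have -> : y - (b + s *: (a - b)) = (1 - s) *: (y - b) + s *: (y - a).
  rewrite scalerBl scale1r -[RHS]addrA (addrC (- _)) -scalerBr opprB.
  by rewrite (addrC (y - a)) subrKA opprD addrA -scalerN opprB.
apply: le_lt_trans (ler_normD _ _) _.
rewrite !normrZ (ger0_norm s0) ger0_norm ?subr_ge0//.
(* In each case one of the weights [1 - s] and [s] is visibly positive, which makes the combined
   inequality strict. *)
have [sr|sr] := leP s (1 / 2); nra.
Qed.

(** * Danskin's argument for an abstract family [d x] with gradients [p x] *)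

Section MaxFunction.
Context {R : realType} {J : nat} {T : topologicalType}.
Variables (C : set T) (U : set 'rV[R]_J) (d : T -> 'rV[R]_J -> R).
Variables (p : T -> 'rV[R]_J -> 'rV[R]_J) (F : 'rV[R]_J -> \bar R).
Hypotheses (C_neq0 : C !=set0) (C_compact : compact C) (U_open : open U).
Hypothesis d_cont : forall x y, C x -> U y ->
  d q.1 q.2 @[q --> (x, y)] --> d x y.
Hypothesis p_cont : forall x y, C x -> U y ->
  p q.1 q.2 @[q --> (x, y)] --> p x y.
Hypothesis d_derive : forall x y w, C x -> U y ->
  is_derive y w (d x) (dot (p x y) w).

Definition argmax y : set T := [set x | C x /\ forall z, C z -> d z y <= d x y].

Hypothesis F_max : forall y x, U y -> argmax y x -> F y = (d x y)%:E.

Lemma max_arg_cont x y : C x -> U y -> d x' y @[x' --> x] --> d x y.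
Proof.
move=> Cx Uy; apply: (cvg_comp (fun x' => (x', y)) _ _ (d_cont Cx Uy)).
exact: (cvg_pair (@cvg_id _ (nbhs x)) (cvg_cst y)).
Qed.

Lemma slope_arg_cont x y : C x -> U y -> p x' y @[x' --> x] --> p x y.
Proof.
move=> Cx Uy; apply: (cvg_comp (fun x' => (x', y)) _ _ (p_cont Cx Uy)).
exact: (cvg_pair (@cvg_id _ (nbhs x)) (cvg_cst y)).
Qed.

Lemma argmax_neq0 y : U y -> argmax y !=set0.
Proof.
move=> Uy; have [|x /set_mem Cx xmax] :=
    @compact_EVT_max _ _ (fun x => d x y) _ C_neq0 C_compact.
  by apply: continuous_in_subspaceT => x /set_mem Cx; exact: max_arg_cont.
by exists x; split=> // z Cz; apply: xmax; exact/mem_set.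
Qed.

(** A cluster point taken in [C] is again a maximizer: a strictly better competitor would also beat
    all nearby points, among them maximizers. *)
Lemma argmax_compact y : U y -> compact (argmax y).
Proof.
move=> Uy G PG Gargmax.
have [|x [Cx xG]] := C_compact PG; first by apply: filterS Gargmax => x [].
exists x; split=> //; split=> // z Cz; rewrite leNgt; apply/negP => xz.
have [x' [[_ /(_ z Cz)]]] := xG _ _ Gargmax (cvgr_lt _ (max_arg_cont Cx Uy) _ xz).
by rewrite leNgt => /negP.
Qed.

(* Compactness of C turns the pointwise dichotomy "x is not a maximizer at y,
   or the slope at x is at most m" into a uniform one near y. *)
Lemma slope_near y w (m e : R) : U y -> 0 < e ->
  (forall x, argmax y x -> dot (p x y) w <= m) ->
  exists r : R, [/\ 0 < r, ball y r `<=` U &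
    forall a b x, ball y r a -> ball y r b -> argmax a x ->
      dot (p x b) w <= m + e].
Proof.
move=> Uy e0 m_ub.
(* Two independent points near [y] are needed: [q.1], where [x'] is maximal, and [q.2], where the
   slope is evaluated; the mean value theorem provides an intermediate point distinct from the
   former. *)
have cover x : C x -> \forall x' \near x & q \near nbhs (y, y),
    C x' -> argmax q.1 x' -> dot (p x' q.2) w <= m + e.
  move=> Cx.
  have to_x : i.1 @[i --> (x, (y, y))] --> x by exact: cvg_fst.
  have to_yy : i.2 @[i --> (x, (y, y))] --> (y, y) by exact: cvg_snd.
  have to_y1 : i.2.1 @[i --> (x, (y, y))] --> y.
    exact: (cvg_comp _ _ to_yy cvg_fst).
  have to_y2 : i.2.2 @[i --> (x, (y, y))] --> y.
    exact: (cvg_comp _ _ to_yy cvg_snd).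
  have [xmax|] := pselect (argmax y x).
    have pw : dot (p i.1 i.2.2) w @[i --> (x, (y, y))] --> dot (p x y) w.
      apply: (@cvg_dot _ _ _ (nbhs (x, (y, y))) _ _ (cst w)).
        exact: (cvg_comp _ _ (cvg_pair to_x to_y2) (p_cont Cx Uy)).
      exact: cvg_cst.
    have lt_me : dot (p x y) w < m + e.
      by rewrite (le_lt_trans (m_ub _ xmax))// ltrDl.
    by apply: filterS (cvgr_le _ pw _ lt_me) => i + _ _.
  (* Some [z] beats [x] at [y]; by joint continuity it beats every nearby [x'] at every nearby
     point, so such an [x'] is not maximal there. *)
  move/not_andP => [//|/existsNP[z /not_implyP[Cz /negP]]].
  rewrite -ltNge => xz.
  have dx : d i.1 i.2.1 @[i --> (x, (y, y))] --> d x y.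
    exact: (cvg_comp _ _ (cvg_pair to_x to_y1) (d_cont Cx Uy)).
  have dz : d z i.2.1 @[i --> (x, (y, y))] --> d z y.
    exact: (cvg_comp _ _ (cvg_pair (cvg_cst z) to_y1) (d_cont Cz Uy)).
  have dzx : d z y - d x y > 0 by rewrite subr_gt0.
  apply: filterS (cvgr_gt _ (cvgB dz dx) _ dzx) => i /=.
  by rewrite subr_gt0 ltNge => /negP lt_zx _ [_ /(_ z Cz)].
have /near_covering_withinP/(_ _ _ _ _ cover) :=
  (iffLR (compact_near_coveringP C)) C_compact.
move=> /nbhs_ballP[r r0 Hr].
have /nbhs_ballP[r' r'0 Hr'] : nbhs y U by exact: open_nbhs_nbhs.
exists (Num.min r r'); split.
- by rewrite lt_min r0.
- by move=> a ya; apply/Hr'/(le_ball _ ya); rewrite ge_min lexx orbT.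
- move=> a b x ya yb ax; have [Cx _] := ax; apply: (Hr (a, b) _ x Cx ax).
  have rr' : Num.min r r' <= r by rewrite ge_min lexx.
  by split=> /=; [exact: le_ball rr' _ ya|exact: le_ball rr' _ yb].
Qed.

Lemma increment x a b : C x ->
  (forall s : R, 0 <= s -> s <= 1 -> U (b + s *: (a - b))) ->
  exists s : R, [/\ 0 <= s, s <= 1 &
    d x a - d x b = dot (p x (b + s *: (a - b))) (a - b)].
Proof.
move=> Cx Uab.
have [s s0 s1|s [s0 s1]] := @mean_value R 'rV[R]_J (d x)
  (fun z => dot (p x z) (a - b)) b (a - b).
  by apply: d_derive => //; exact: Uab.
by rewrite (addrC b) subrK => ->; exists s.
Qed.

(** A maximizer at [a] is still a competitor at [b]. *)
Lemma F_sub_le a b x : U a -> U b -> argmax a x ->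
  (F a - F b <= (d x a - d x b)%:E)%E.
Proof.
move=> Ua Ub ax; have [z bz] := argmax_neq0 Ub.
rewrite (F_max Ua ax) (F_max Ub bz) -EFinB lee_fin lerB//.
by case: bz => _; apply; case: ax.
Qed.

Lemma clarke_le y w m : U y ->
  (forall x, argmax y x -> dot (p x y) w <= m) ->
  (clarke_subderivative F y w <= m%:E)%E.
Proof.
move=> Uy m_ub; apply/lee_addgt0Pr => e e0.
have [r [r0 rU Hr]] := slope_near Uy e0 m_ub.
apply: limf_esup_le.
(* For [t < t0] the shift [t *: w] is shorter than [r / 2], so [z] and [z + t *: w] both stay in the
   ball of radius [r]; the added 1 covers [w = 0]. *)
pose t0 := r / 2 / (`|w| + 1).
have t0_gt0 : 0 < t0 by rewrite !divr_gt0// ltr_wpDl.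
exists (ball y (r / 2), [set t | 0 < t < t0]).
  split=> /=; first by apply: nbhsx_ballx; rewrite divr_gt0.
  near=> t; apply/andP; split; near: t; first exact: nbhs_right_gt.
  exact: nbhs_right_lt.
move=> [z t]/= [yz /andP[t_gt0 t_lt]].
have yrz : ball y r z.
  by apply: le_ball yz; rewrite ler_pdivrMr// ler_peMr ?ltW//; lra.
have yrzt : ball y r (z + t *: w).
  rewrite [r]splitr; apply: ball_triangle yz _.
  rewrite -ball_normE /= opprD addrA subrr sub0r normrN normrZ gtr0_norm//.
  have w1 : 0 < `|w| + 1 by rewrite ltr_wpDl.
  move: t_lt; rewrite /t0 ltr_pdivlMr//; apply: le_lt_trans.
  by rewrite ler_pM2l// lerDl.
have [x xmax] := argmax_neq0 (rU _ yrzt).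
have t_inv : (0 <= (t^-1)%:E)%E by rewrite lee_fin invr_ge0 ltW.
apply: le_trans (lee_wpmul2r t_inv (F_sub_le (rU _ yrzt) (rU _ yrz) xmax)) _.
rewrite -EFinM lee_fin ler_pdivrMr//.
have [|s s0 s1|s [s0 s1 ->]] := @increment x (z + t *: w) z.
- by case: xmax.
- by apply/rU/ball_segment.
rewrite addrAC subrr add0r dotZr mulrC ler_pM2r//.
apply: (Hr _ _ _ yrzt _ xmax).
by have := ball_segment yrzt yrz s0 s1; rewrite addrAC subrr add0r.
Unshelve. all: by end_near. Qed.

(** The maximizer [x] at [y] is a competitor at [y + t *: w], so the quotients of [F] dominate those
    of [d x], which tend to the slope. *)
Lemma dini_ge y w x : U y -> argmax y x ->
  ((dot (p x y) w)%:E <= dini_subderivative F y w)%E.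
Proof.
move=> Uy xmax; have [Cx _] := xmax; apply/lee_subgt0Pr => e e0.
apply: limf_einf_ge.
have [dxd dxE] := d_derive w Cx Uy.
have Uyt : \forall t \near 0^'+, U (y + t *: w).
  have : y + t *: w @[t --> (0 : R)] --> y.
    have tw : t *: w @[t --> (0 : R)] --> (0 : R) *: w.
      by apply: cvgZr_tmp; exact: cvg_id.
    rewrite -[X in _ --> X]addr0 -[X in _ --> y + X](scale0r w).
    exact: (cvgD (cvg_cst y) tw).
  move=> /cvg_at_right_filter; apply.
  by apply: open_nbhs_nbhs.
have lt_e : dot (p x y) w - e < 'D_w (d x) y by rewrite dxE ltrBlDr ltrDl.
have near_e := cvgr_gt _ (cvg_dnbhs_at_right dxd) _ lt_e.
near=> t.
have Ut : U (y + t *: w) by near: t; exact: Uyt.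
have t_gt0 : 0 < t by near: t; exact: nbhs_right_gt.
have t_inv : (0 <= (t^-1)%:E)%E by rewrite lee_fin invr_ge0 ltW.
have [z zmax] := argmax_neq0 Ut; have [_ /(_ x Cx) le_d] := zmax.
rewrite (F_max Uy xmax) (F_max Ut zmax) -!EFinB -EFinM lee_fin.
rewrite ler_pdivlMr//.
have : dot (p x y) w - e < t^-1 * (d x (t *: w + y) - d x y).
  by near: t; exact: near_e.
rewrite ltr_pdivlMl// mulrC (addrC _ y) => /ltW lt_t.
by rewrite (le_trans lt_t)// lerD2r.
Unshelve. all: by end_near. Qed.

(** The chain maximal slope, Dini, Clarke, maximal slope closes up; compactness of the set of
    maximizers makes the maximum attained. *)
Lemma directional_derivatives y w : U y ->
  exists m : R, [/\ is_max [set dot (p x y) w | x in argmax y] m,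
    dini_subderivative F y w = m%:E & clarke_subderivative F y w = m%:E].
Proof.
move=> Uy.
have [|x /set_mem xmax x_ub] := @compact_EVT_max _ _ (fun x => dot (p x y) w) _
    (argmax_neq0 Uy) (argmax_compact Uy).
  apply: continuous_in_subspaceT => x /set_mem[Cx _].
  exact: (cvg_dot (slope_arg_cont Cx Uy) (cvg_cst w)).
exists (dot (p x y) w).
have dini_max := dini_ge w Uy xmax.
have clarke_max : (clarke_subderivative F y w <= (dot (p x y) w)%:E)%E.
  by apply: clarke_le => // z zmax; apply/x_ub/mem_set.
split.
- by split; [exists x|move=> _ [z zmax <-]; apply/x_ub/mem_set].
- by apply/eqP; rewrite eq_le dini_max (le_trans (dini_le_clarke _ _ _)).
- by apply/eqP; rewrite eq_le clarke_max (le_trans dini_max)// dini_le_clarke.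
Qed.

(** Since the maximal slope is attained, lying below it amounts to lying below the slope of some
    maximizer. *)
Lemma clarke_subdifferentialP y v : U y ->
  clarke_subdifferential F y v <->
  forall w, exists2 x, argmax y x & dot v w <= dot (p x y) w.
Proof.
move=> Uy; split=> Hv w; have [m [[[x xmax xm] m_ub] _ Fm]] :=
    directional_derivatives w Uy.
  by have := Hv w; rewrite Fm lee_fin -xm; exists x.
have [z zmax vz] := Hv w; rewrite Fm lee_fin (le_trans vz)//.
by apply: m_ub; exists z.
Qed.

Lemma dini_clarke_subdifferential y : U y ->
  dini_subdifferential F y = clarke_subdifferential F y.
Proof.
move=> Uy; apply/seteqP; split=> v Hv w; have := Hv w;
  by have [m [_ -> ->]] := directional_derivatives w Uy.
Qed.

(** Constant sequences give one inclusion. For the other, a subgradient at [x_ n] lies below a slope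
    at a maximizer there, hence below [m + e] by [slope_near] with both points equal to [x_ n], and
    the bound passes to the limit. *)
Lemma limiting_dini_subdifferential y : U y ->
  limiting_subdifferential F y = dini_subdifferential F y.
Proof.
move=> Uy; apply/seteqP; split=> [v [x_ [v_ [xy vv Hv]]]|v Hv]; last first.
  by exists (cst y), (cst v); split=> //; exact: cvg_cst.
rewrite dini_clarke_subdifferential// => w.
have [m [[_ m_ub] _ ->]] := directional_derivatives w Uy.
rewrite lee_fin; apply/ler_addgt0Pr => e e0.
have [|r [r0 rU Hr]] := @slope_near y w m e Uy e0.
  by move=> x xmax; apply: m_ub; exists x.
apply: (cvgr_to_le (cvg_dot vv (cvg_cst w))).
have : \forall n \near \oo, ball y r (x_ n) by apply/xy/nbhsx_ballx.
apply: filterS => n yn.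
have := Hv n; rewrite dini_clarke_subdifferential; last exact: rU.
move=> /(clarke_subdifferentialP _ (rU _ yn))/(_ w)[x xmax] vx.
by rewrite (le_trans vx)//; exact: Hr xmax.
Qed.

Lemma max_locally_lipschitz y : U y -> finite_locally_lipschitz_at F y.
Proof.
move=> Uy; pose N (v : 'rV[R]_J) : R := \sum_j `|v 0 j|.
have N_cont (v : 'rV[R]_J) : N u @[u --> v] --> N v.
  apply: (@cvg_sumr R R _ _ (nbhs v)) => j; apply: cvg_norm.
  exact: coord_continuous.
have [|x0 /set_mem Cx0 x0_ub] :=
    @compact_EVT_max _ _ (fun x => N (p x y)) _ C_neq0 C_compact.
  apply: continuous_in_subspaceT => x /set_mem Cx.
  exact: (cvg_comp _ _ (slope_arg_cont Cx Uy) (N_cont _)).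
(* The largest [N]-size of the slopes at [y], enlarged by 1 so that by compactness of [C] it still
   bounds all slopes near [y]. *)
exists (N (p x0 y) + 1).
have cover x : C x -> \forall x' \near x & c \near nbhs y,
    C x' -> N (p x' c) <= N (p x0 y) + 1.
  move=> Cx; have lt1 : N (p x y) < N (p x0 y) + 1.
    by rewrite (le_lt_trans (x0_ub _ (mem_set Cx)))// ltrDl.
  have pN : N (p q.1 q.2) @[q --> (x, y)] --> N (p x y).
    exact: (cvg_comp _ _ (p_cont Cx Uy) (N_cont _)).
  by apply: filterS (cvgr_le _ pN _ lt1) => q + _.
have /near_covering_withinP/(_ _ _ _ _ cover) :=
  (iffLR (compact_near_coveringP C)) C_compact.
move=> /nbhs_ballP[r r0 Hr].
have /nbhs_ballP[r' r'0 Hr'] : nbhs y U by exact: open_nbhs_nbhs.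
have e0 : 0 < Num.min r r' by rewrite lt_min r0.
set e := Num.min r r' in e0.
have er : e <= r by rewrite ge_min lexx.
have er' : e <= r' by rewrite ge_min lexx orbT.
have eU c : ball y e c -> U c by move=> yc; apply/Hr'/(le_ball er').
have F_lip a b : ball y e a -> ball y e b ->
    (F a - F b <= ((N (p x0 y) + 1) * enorm (a - b))%:E)%E.
  move=> ya yb; have [x xmax] := argmax_neq0 (eU _ ya).
  have [Cx _] := xmax.
  apply: le_trans (F_sub_le (eU _ ya) (eU _ yb) xmax) _; rewrite lee_fin.
  have [|s [s0 s1 ->]] := @increment x a b Cx.
    by move=> s s0 s1; exact/eU/ball_segment.
  rewrite (le_trans (ler_norm _))// (le_trans (ler_norm_dot _ _))//.
  rewrite ler_wpM2r ?sqrtr_ge0//; apply: (Hr _ _ x Cx).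
  by apply: (le_ball er); exact: ball_segment.
have F_fin a : ball y e a -> F a \is a fin_num.
  move=> /eU Ua; have [x xmax] := argmax_neq0 Ua.
  by rewrite (F_max Ua xmax).
have enormC (u v : 'rV[R]_J) : enorm (u - v) = enorm (v - u).
  by rewrite -opprB /enorm dotNl dotNr opprK.
exists (ball y e, ball y e); first by split; exact: nbhsx_ballx.
move=> [a b]/= [ya yb]; split; [exact: F_fin|exact: F_fin|].
have := F_lip _ _ ya yb; have := F_lip _ _ yb ya.
rewrite -(fineK (F_fin _ ya)) -(fineK (F_fin _ yb)) -!EFinB !lee_fin /=.
rewrite (enormC b).
by move=> ba ab; rewrite ler_norml ab andbT lerNl opprB.
Qed.

End MaxFunction.

(** * Bregman distances *)

(** The right-hand side says that [v] lies below the support function of the affine image of [A];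
    passing to the hull does not change this function, and separation recovers the compact convex
    image from it. *)
Lemma image_convP (R : realType) (J : nat) (A : set 'rV[R]_J) (y v : 'rV[R]_J)
    (M : 'M[R]_J) : A !=set0 -> compact A ->
  [set (y - x) *m M | x in conv A] v <->
  forall w, exists2 x, A x & dot v w <= dot ((y - x) *m M) w.
Proof.
move=> A0 cA; pose h (x : 'rV[R]_J) := (y - x) *m M.
have h_cont : continuous h.
  move=> x; apply: (cvg_mulmx (F := nbhs x)); last exact: cvg_cst.
  exact: (cvgB (cvg_cst y) (@cvg_id _ (nbhs x))).
have h_conv x1 x2 t : h (t *: x1 + (1 - t) *: x2) = t *: h x1 + (1 - t) *: h x2.
  rewrite /h !scalemxAl -mulmxDl; congr (_ *m _).
  by apply/rowP => j; rewrite !mxE; ring.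
split=> [[x Ax <-] w|Hv].
  have [|z /set_mem Az z_ub] :=
      @compact_EVT_max _ _ (fun x => dot (h x) w) _ A0 cA.
    apply: continuous_subspaceT => z.
    exact: (cvg_dot (@h_cont z) (cvg_cst w)).
  exists z => //.
  (* This preimage of a half-space is convex and contains [A]. *)
  suff : conv A `<=` [set x | dot (h x) w <= dot (h z) w] by exact.
  apply: conv_min; last by move=> x' Ax'; apply/z_ub/mem_set.
  apply/convex_setP => x1 x2 t /= Hx1 Hx2 t0 t1.
  rewrite h_conv dotDl !dotZl.
  rewrite [leRHS](_ : _ = t * dot (h z) w + (1 - t) * dot (h z) w); last by ring.
  by apply: lerD; rewrite ler_wpM2l// subr_ge0.
apply: (@mem_compact_convex _ _ (h @` conv A)).
- by have [x Ax] := A0; exists (h x), x => //; exact: sub_conv.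
- by apply: continuous_compact; [exact: continuous_subspaceT|exact: conv_compact].
- apply/convex_setP => _ _ t [x1 Ax1 <-] [x2 Ax2 <-] t0 t1.
  exists (t *: x1 + (1 - t) *: x2); last exact: h_conv.
  by have /convex_setP := @conv_convex _ _ A; apply.
- move=> w; have [x Ax vx] := Hv w; exists (h x) => //.
  by exists x => //; exact: sub_conv.
Qed.

(** * Directional derivatives of the inner product, of [f] and of its gradient *)

Section Derivatives.
Context {R : realType} {J : nat}.
Implicit Types v w y : 'rV[R]_J.

Lemma is_derive_dot (a b : 'rV[R]_J -> 'rV[R]_J) y w da db :
  is_derive y w a da -> is_derive y w b db ->
  is_derive y w (fun z => dot (a z) (b z)) (dot da (b y) + dot (a y) db).
Proof.
have coord (c : 'rV[R]_J -> 'rV[R]_J) dc j :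
    is_derive y w c dc -> is_derive y w (fun z => c z 0 j) (dc 0 j).
  move=> [c_der <-]; split; first by move/derivable_mxP : c_der; apply.
  by rewrite derive_mx// mxE.
move=> Ha Hb; have -> : (fun z => dot (a z) (b z)) =
    \sum_(j < J) ((fun z => a z 0 j) * (fun z => b z 0 j)).
  by apply/funext => z; rewrite fct_sumE.
have -> : dot da (b y) + dot (a y) db =
    \sum_(j < J) (a y 0 j *: db 0 j + b y 0 j *: da 0 j).
  rewrite addrC -big_split; apply: eq_bigr => j _ /=.
  by rewrite [da _ _ * _]mulrC.
by apply: is_derive_sum => j; apply: is_deriveM; exact: coord.
Qed.

Lemma is_derive_gradient (f : 'rV[R]_J -> \bar R) y v :
  differentiable (fine \o f) y ->
  is_derive y v (fine \o f) (dot (gradient f y) v).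
Proof.
move=> df; split; first exact: diff_derivable.
rewrite deriveE// {1}(row_sum_delta v) linear_sum; apply: eq_bigr => j _.
by rewrite linearZ/= mxE deriveE// mulrC.
Qed.

Lemma is_derive_hessian (f : 'rV[R]_J -> \bar R) y v :
  differentiable (gradient f) y ->
  is_derive y v (gradient f) (v *m hessian f y).
Proof.
by move=> dg; split; [exact: diff_derivable|exact: deriveEjacobian].
Qed.

Lemma dot_hessianC (f : 'rV[R]_J -> \bar R) y u w :
  (\forall z \near y, differentiable (fine \o f) z) ->
  differentiable (gradient f) y ->
  dot (u *m hessian f y) w = dot (w *m hessian f y) u.
Proof.
move=> df dg; rewrite /hessian -!deriveEjacobian// !deriveE//.
apply: (@schwarz _ _ (fine \o f)) dg.
by apply: filterS df => z dfz v; exact: is_derive_gradient.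
Qed.

End Derivatives.

Section Bregman.
Context {R : realType} {J : nat}.
Variables (f : 'rV[R]_J -> \bar R) (C : set 'rV[R]_J).
Hypothesis f_proper : proper f.
Hypothesis f_C2 : twice_continuously_differentiable f (intdom f).
Hypothesis C_intdom : C `<=` intdom f.

Definition real_bregman x y : R :=
  fine (f x) - fine (f y) - dot (gradient f y) (x - y).

(** The gradient at [y] of [real_bregman x]. *)
Definition bregman_slope x y : 'rV[R]_J := (y - x) *m hessian f y.

Lemma intdom_fin_num x : intdom f x -> f x \is a fin_num.
Proof.
move=> /interior_subset fx; rewrite fin_real// fx andbT ltNye.
by have [+ _] := f_proper; apply.
Qed.

Lemma bregmanE x y : intdom f x -> intdom f y ->
  bregman f x y = (real_bregman x y)%:E.
Proof.
move=> Ux Uy; rewrite /bregman mem_set// /real_bregman !EFinB.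
by rewrite !fineK// intdom_fin_num.
Qed.

Lemma real_bregman_cont x y : C x -> intdom f y ->
  real_bregman q.1 q.2 @[q --> (x, y)] --> real_bregman x y.
Proof.
move=> /C_intdom Ux Uy.
have [dfx _ _] := f_C2 Ux; have [dfy dgy _] := f_C2 Uy.
have to_x : q.1 @[q --> (x, y)] --> x by exact: cvg_fst.
have to_y : q.2 @[q --> (x, y)] --> y by exact: cvg_snd.
apply: cvgB; first apply: cvgB.
- exact: (cvg_comp _ _ to_x (differentiable_continuous dfx)).
- exact: (cvg_comp _ _ to_y (differentiable_continuous dfy)).
- apply: (cvg_dot (F := nbhs (x, y))).
    exact: (cvg_comp _ _ to_y (differentiable_continuous dgy)).
  exact: (cvgB to_x to_y).
Qed.

Lemma bregman_slope_cont x y : intdom f y ->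
  bregman_slope q.1 q.2 @[q --> (x, y)] --> bregman_slope x y.
Proof.
move=> Uy; have [_ _ Hy] := f_C2 Uy.
have to_x : q.1 @[q --> (x, y)] --> x by exact: cvg_fst.
have to_y : q.2 @[q --> (x, y)] --> y by exact: cvg_snd.
apply: (cvg_mulmx (F := nbhs (x, y))); first exact: (cvgB to_y to_x).
exact: (cvg_comp _ _ to_y Hy).
Qed.

Lemma intdom_open : open (intdom f).
Proof. exact: open_interior. Qed.

(* Symmetry of the Hessian moves it from w onto y - x. *)
Lemma is_derive_real_bregman x y w : intdom f y ->
  is_derive y w (real_bregman x) (dot (bregman_slope x y) w).
Proof.
move=> Uy; have [dfy dgy _] := f_C2 Uy.
have near_df : \forall z \near y, differentiable (fine \o f) z.
  have : nbhs y (intdom f) by exact: open_nbhs_nbhs (conj intdom_open Uy).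
  by apply: filterS => z /f_C2[].
rewrite /bregman_slope dot_hessianC//.
have D1 := is_derive_gradient w dfy.
have D2 : is_derive y w (fun z => x - z) (0 - w) by exact: is_deriveB.
have D3 := is_derive_dot (is_derive_hessian w dgy) D2.
have D4 := is_deriveB (is_deriveB (is_derive_cst (fine (f x)) y w) D1) D3.
(* The two terms pairing the gradient with [w], from [f y] and from [x - y], cancel; only the
   Hessian term remains. *)
apply: is_derive_eq D4 _.
by rewrite sub0r add0r !dotBr dotNr; ring.
Qed.

Lemma left_farthest_pointsE y : intdom f y ->
  left_farthest_points f C y = argmax C real_bregman y.
Proof.
move=> Uy; apply/seteqP; split=> x [Cx xmax]; split=> // z Cz.
  rewrite -lee_fin -!bregmanE; [|exact: C_intdom|by []|exact: C_intdom|by []].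
  exact: xmax.
rewrite !bregmanE ?lee_fin; [|exact: C_intdom|by []|exact: C_intdom|by []].
exact: xmax.
Qed.

Lemma left_farthest_distE y x : intdom f y -> argmax C real_bregman y x ->
  left_farthest_dist f C y = (real_bregman x y)%:E.
Proof.
move=> Uy [Cx xmax]; apply/eqP; rewrite eq_le; apply/andP; split.
  apply: ge_ereal_sup => _ [z Cz <-].
  by rewrite bregmanE ?lee_fin; [exact: xmax|exact: C_intdom|].
by apply: ereal_sup_ubound; exists x => //; rewrite bregmanE//; exact: C_intdom.
Qed.

End Bregman.

Theorem proposition5p1 (R : realType) (J : nat)
    (f : 'rV[R]_J -> \bar R) (C : set 'rV[R]_J)
    (f_legendre : convex_legendre f) (f_coercive : one_coercive f)
    (C_neq0 : C !=set0) (C_bounded : bounded_set C) (C_closed : closed C)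
    (C_intdom : C `<=` intdom f)
    (f_C2 : twice_continuously_differentiable f (intdom f)) :
  (forall y : 'rV[R]_J, intdom f y ->
     (forall w : 'rV[R]_J, exists m : R,
        [/\ is_max [set dot ((y - x) *m hessian f y) w
                   | x in left_farthest_points f C y] m,
            dini_subderivative (left_farthest_dist f C) y w = m%:E &
            clarke_subderivative (left_farthest_dist f C) y w = m%:E]) /\
     [/\ limiting_subdifferential (left_farthest_dist f C) y
           = dini_subdifferential (left_farthest_dist f C) y,
         dini_subdifferential (left_farthest_dist f C) y
           = clarke_subdifferential (left_farthest_dist f C) y &
         clarke_subdifferential (left_farthest_dist f C) y
           = [set (y - x) *m hessian f y
             | x in conv (left_farthest_points f C y)]]) /\
  (forall y : 'rV[R]_J, intdom f y ->
     clarke_regular_at (left_farthest_dist f C) y).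
Proof.
have [f_proper _ _ _ _] := f_legendre.
have C_compact : compact C by exact: bounded_closed_compact.
(* The hypotheses of the abstract maximum are collected for the real Bregman distance, its slope and
   the open set [intdom f]. *)
have U_open := @intdom_open _ _ f.
have d_cont := real_bregman_cont f_C2 C_intdom.
have p_cont x y (_ : C x) := @bregman_slope_cont _ _ f f_C2 x y.
have d_derive x y w (_ : C x) :=
  @is_derive_real_bregman _ _ f f_C2 x y w.
have F_max := left_farthest_distE f_proper C_intdom.
have subderivatives := directional_derivatives C_neq0 C_compact U_open d_cont
  p_cont d_derive F_max.
split=> y Uy; last first.
  split; first exact: (max_locally_lipschitz C_neq0 C_compact U_open d_cont
    p_cont d_derive F_max).
  by move=> w; have [m [_ -> ->]] := subderivatives y w Uy.
rewrite (left_farthest_pointsE f_proper C_intdom Uy); split.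
  by move=> w; exact: subderivatives.
split.
- exact: (limiting_dini_subdifferential C_neq0 C_compact U_open d_cont
    p_cont d_derive F_max).
- exact: (dini_clarke_subdifferential C_neq0 C_compact U_open d_cont
    p_cont d_derive F_max).
- have Q0 := argmax_neq0 C_neq0 C_compact d_cont Uy.
  have cQ := argmax_compact C_compact d_cont Uy.
  (* Both sets are characterized by the same inequalities against slopes at maximizers. *)
  apply/seteqP; split=> v.
    move=> /(clarke_subdifferentialP C_neq0 C_compact U_open d_cont
      p_cont d_derive F_max _ Uy) Hv.
    exact/(image_convP _ _ _ Q0 cQ).
  move=> /(image_convP _ _ _ Q0 cQ) Hv.
  exact/(clarke_subdifferentialP C_neq0 C_compact U_open d_cont
      p_cont d_derive F_max _ Uy).
Qed.
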